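(* Let $G$ be a finite Abelian group with neutral element $e$, let $k$ be a positive integer, and let $A$ be a unital complex Banach algebra equipped with a $G$-graded structure $A=\bigoplus_{g\in G}A_g$. Assume $A$ has no nontrivial idempotent. Let $a\in A_g$ for some $g\neq e$ (a nontrivial homogeneous element). Then $0$ belongs to the convex hull of the spectrum $\mathrm{sp}(a^k)$. Moreover, if $A$ is commutative and $a$ is invertible, then $a^k$ does not lie in the connected component of the identity in the group of invertible elements of $A$.
   Context: A $G$-graded structure on a unital complex Banach algebra $A$ (for a finite group $G$) is a direct sum decomposition $A=\bigoplus_{g\in G}A_g$ of $A$ into closed linear subspaces $A_g$ such that $A_gA_h\subseteq A_{gh}$ for all $g,h\in G$. An element of some $A_g$ is homogeneous; it is nontrivial homogeneous if $g\neq e$. A nontrivial idempotent is an element $p$ with $p^2=p$, $p\neq 0,1$. For $x\in A$, $\mathrm{sp}(x)$ is the set of $\lambda\in\mathbb{C}$ such that $x-\lambda 1$ is not invertible. *)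

(* Defs.v *)
From HB Require Import structures.
From mathcomp Require Import all_boot all_order all_algebra all_fingroup.
From mathcomp Require Import complex.
From mathcomp Require Import all_classical all_reals all_analysis.
Set Implicit Arguments. Unset Strict Implicit. Unset Printing Implicit Defensive.
Import Order.TTheory GRing.Theory Num.Theory.
Import numFieldNormedType.Exports.
Local Open Scope classical_set_scope.
Local Open Scope ring_scope.

(* A unital Banach algebra over a numeric field K: a complete normed K-module
   equipped with an associative, K-bilinear, unital multiplication with
   submultiplicative norm, and 1 <> 0.
   (HB cannot join GRing.PzSemiRing with the normed hierarchy, because
   Num.NumDomain already combines them without a named join; hence the
   multiplication is given as an explicit mixin.) *)
HB.mixin Record isBanachAlgebra (K : numFieldType) A of CompleteNormedModule K A := {
  bmul : A -> A -> A;
  bone : A;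
  bmulA : forall x y z, bmul x (bmul y z) = bmul (bmul x y) z;
  bmul1l : forall x, bmul bone x = x;
  bmul1r : forall x, bmul x bone = x;
  bmulDl : forall x y z, bmul (x + y) z = bmul x z + bmul y z;
  bmulDr : forall x y z, bmul x (y + z) = bmul x y + bmul x z;
  bmulZl : forall (c : K) x y, bmul (c *: x) y = c *: bmul x y;
  bmulZr : forall (c : K) x y, bmul x (c *: y) = c *: bmul x y;
  bnormM : forall x y, `|bmul x y| <= `|x| * `|y|;
  bone_neq0 : bone != 0
}.

#[short(type="banachAlgType")]
HB.structure Definition BanachAlgebra (K : numFieldType) :=
  {A of CompleteNormedModule K A & isBanachAlgebra K A}.

Notation "x *b y" := (bmul x y) (at level 40, left associativity).

Definition bexp (K : numFieldType) (A : banachAlgType K) (x : A) (n : nat) : A :=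
  iter n (bmul x) bone.

Section Defs.
Variables (R : realType).
Local Notation C := (R[i]).
Variable (A : banachAlgType C).

Definition invertible (x : A) : Prop := exists y : A, x *b y = bone /\ y *b x = bone.

Definition invertibles : set A := [set x | invertible x].

Definition spectrum (x : A) : set C := [set l : C | ~ invertible (x - l *: bone)].

Definition nontrivial_idempotent (p : A) : Prop :=
  p *b p = p /\ p <> 0 /\ p <> bone.

Definition graded_structure (gT : finGroupType) (V : gT -> set A) : Prop :=
  [/\ forall g, closed (V g),
      forall g, V g 0 /\ (forall (c : C) (x y : A), V g x -> V g y -> V g (c *: x + y)),
      forall x : A, exists f : gT -> A, (forall g, V g (f g)) /\ x = \sum_(g : gT) f g,
      forall f1 f2 : gT -> A, (forall g, V g (f1 g)) -> (forall g, V g (f2 g)) ->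
        \sum_(g : gT) f1 g = \sum_(g : gT) f2 g -> forall g, f1 g = f2 g
    & forall g h (x y : A), V g x -> V h y -> V (g * h)%g (x *b y)].
End Defs.

Definition convex_hull_C (R : realType) (S : set R[i]) : set R[i] :=
  [set z | exists (n : nat) (t : 'I_n -> R) (w : 'I_n -> R[i]),
     [/\ forall i, 0 <= t i, \sum_(i < n) t i = 1, forall i, S (w i)
       & z = \sum_(i < n) (t i)%:C%C * w i]].

(* Main.v *)
(** Choose a character chi of G with chi g <> 1 and let phi be the automorphism
    of A acting on A_h as the scalar chi h; it satisfies phi^n = id for n = |G|.
    Let D be the bicommutant of a: it is commutative, closed, phi-stable and
    stable under inversion. Elements of D near 1 have N-th roots in D, so the
    set of N-th powers is relatively clopen in any connected set of invertible
    elements of D containing 1, hence exhausts it.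

    Suppose that a^k is, up to a scalar, such a power z^(n k) with z in D. Roots
    of 1 are scalars because A has no nontrivial idempotent, so a = s z^n with
    s scalar, and then phi z = t z with t scalar. From phi^n = id we get
    t^n = 1, hence phi a = a, contradicting chi g <> 1.

    This gives the statement on the connected component at once. For the
    convex hull, either the spectrum of a^k contains 0, or a negative and a
    positive real number, or it misses one of the two real half-lines; in the
    last case the segment from 1 to a^k or to -a^k consists of invertible
    elements of D. *)

Require Import Defs.
From HB Require Import structures.
From mathcomp Require Import all_boot all_order all_algebra all_fingroup.
From mathcomp Require Import all_solvable all_field all_character.
From mathcomp Require Import complex ring lra.
From mathcomp Require Import all_classical all_reals all_analysis.
Import Order.TTheory GRing.Theory Num.Theory.
Import numFieldNormedType.Exports.
Local Open Scope classical_set_scope.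
Local Open Scope ring_scope.

(** * Roots of unity and characters of finite abelian groups *)

Lemma prim_root_exists (F : numClosedFieldType) (n : nat) :
  (0 < n)%N -> exists z : F, n.-primitive_root z.
Proof.
move=> n_gt0; have [r Dp] := closed_field_poly_normal ('X^n - 1 : {poly F}).
rewrite (monicP _) ?monicXnsubC // scale1r in Dp.
have rn1 : all n.-unity_root r by apply/allP=> z; rewrite -root_prod_XsubC -Dp.
have sz_r : (n < (size r).+1)%N.
  by rewrite -(size_prod_XsubC r id) -Dp size_XnsubC.
have [|z] := hasP (has_prim_root n_gt0 rn1 _ sz_r); last by exists z.
by rewrite -separable_prod_XsubC -Dp separable_Xn_sub_1 // pnatr_eq0 -lt0n.
Qed.

(** The irreducible characters of an abelian group are linear and their kernels intersect trivially,
    so one of them differs from 1 at [g]. Its values are algebraic numbers; they are carried over to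
    [F] by writing them as powers of a primitive root [z] and replacing [z] by a primitive root [w]
    of [F] of the same order. *)
Lemma abelian_separating_char (F : numClosedFieldType) (gT : finGroupType)
    (g : gT) :
  abelian [set: gT]%G -> g != 1%g ->
  exists chi : gT -> F,
    [/\ forall x y, chi (x * y)%g = chi x * chi y,
        forall x, chi x ^+ #|gT| = 1 & chi g != 1].
Proof.
move=> abG g1; pose G := [set: gT]%G.
have [i gi] : exists i : Iirr G, 'chi_i g != 1.
  apply/existsP; apply: contraR g1; rewrite negb_exists => /forallP/= h.
  have -> : (g == 1%g) = (g \in (1%g : {set gT})) by rewrite inE.
  rewrite -(TI_cfker_irr G).
  apply/bigcapP => i _; rewrite cfkerEirr inE.
  have := h i; rewrite negbK => /eqP ->.
  by rewrite lin_char1 //; apply/char_abelianP.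
have lini : 'chi_i \is a linear_char by apply/char_abelianP.
have n_gt0 : (0 < #|gT|)%N by apply/card_gt0P; exists g.
have [z zP] := C_prim_root_exists n_gt0.
have [w wP] := @prim_root_exists F _ n_gt0.
have chin x : 'chi_i x ^+ #|gT| = 1.
  rewrite -lin_charX ?inE // -cardsT.
  by rewrite (expg_cardG (finset.in_setT x : x \in G)) lin_char1.
pose e x : nat := sval (prim_rootP zP (chin x)).
have eP x : 'chi_i x = z ^+ e x := svalP (prim_rootP zP (chin x)).
exists (fun x => w ^+ e x); split => [x y|x|].
- apply/eqP; rewrite -exprD (eq_prim_root_expr wP) -(eq_prim_root_expr zP).
  by rewrite exprD -!eP lin_charM ?inE.
- by rewrite exprAC (prim_expr_order wP) expr1n.
- rewrite -(prim_order_dvd wP) (prim_order_dvd zP) -eP.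
  exact: gi.
Qed.

(** * Scalar roots, bicommutants and periodic homomorphisms in an abstract algebra *)

Section AlgebraLemmas.
Context {F : numClosedFieldType} {E : algType F}.
Implicit Types (a b u x y z : E) (s t c w : F).

(* The p j are the spectral projections of u; as they sum to 1, one of them is 1. *)
Lemma unity_root_scalar (N : nat) u :
  (forall p : E, p * p = p -> p = 0 \/ p = 1) -> (0 < N)%N -> u ^+ N = 1 ->
  exists t, u = t%:A.
Proof.
move=> idemE N_gt0 uN.
have [z zP] := @prim_root_exists F _ N_gt0.
have zN := prim_expr_order zP.
have z0 : z != 0.
  by apply: contra_eq_neq zN => ->; rewrite expr0n gtn_eqF // eq_sym oner_neq0.
have N0 : N%:R != 0 :> F by rewrite pnatr_eq0 -lt0n.
pose p (j : nat) : E := N%:R^-1 *: \sum_(i < N) z ^+ (j * i) *: u ^+ i.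
have up j : (z ^+ j *: u) * p j = p j.
  rewrite /p -scalerAr mulr_sumr; congr (_ *: _).
  (* Multiplication by [z ^+ j *: u] shifts the terms of the sum cyclically: the last one becomes
     the first because [u ^+ N = 1] and [z ^+ N = 1]. *)
  case: N N_gt0 uN zN {z0 zP N0 p} => // N _ uN zN.
  rewrite big_ord_recr [RHS]big_ord_recl /= addrC; congr (_ + _).
    rewrite -scalerAl -scalerAr scalerA -exprD -exprS uN -mulnS mulnC exprM zN.
    by rewrite expr1n muln0 expr0.
  apply: eq_bigr => i _; rewrite -scalerAl -scalerAr scalerA -exprD -exprS.
  by rewrite /bump /= -mulnS.
have upi j i : (z ^+ (j * i) *: u ^+ i) * p j = p j.
  rewrite exprM -exprZn; elim: i => [|i IH]; first by rewrite expr0 mul1r.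
  by rewrite exprS -mulrA IH up.
have pp j : p j * p j = p j.
  rewrite {1}/p -scalerAl mulr_suml; under eq_bigr do rewrite upi.
  by rewrite sumr_const card_ord -[p j *+ N]scaler_nat scalerA mulVf // scale1r.
have sp : \sum_(j < N) p j = 1.
  rewrite /p -scaler_sumr exchange_big /=.
  under eq_bigr do rewrite -scaler_suml.
  (* After the exchange, the coefficient of [u ^+ i] is a geometric sum in [z ^+ i]: it is [N] for
     [i = 0] and vanishes otherwise. *)
  rewrite (bigD1 (Ordinal N_gt0)) //= [X in _ + X]big1 => [|i i0].
    under eq_bigr do rewrite muln0 expr0.
    by rewrite sumr_const card_ord addr0 expr0 scalerA mulVf // scale1r.
  have zi1 : z ^+ i != 1.
    rewrite -(prim_order_dvd zP); apply: contra i0 => /dvdn_leq h.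
    rewrite -val_eqE /= -leqn0 leqNgt; apply/negP => /h.
    by rewrite leqNgt ltn_ord.
  have : (z ^+ i - 1) * \sum_(j < N) z ^+ (j * i) = 0.
    under eq_bigr do rewrite mulnC exprM.
    by rewrite -subrX1 exprAC zN expr1n subrr.
  by move/eqP; rewrite mulf_eq0 subr_eq0 (negPf zi1) => /eqP ->; rewrite scale0r.
have [j pj] : exists j : 'I_N, p j = 1.
  apply: contrapT => h; have: (1 : E) == 0; last by rewrite oner_eq0.
  rewrite -sp big1 // => j _; have [//|p1] := idemE _ (pp j).
  by case: h; exists j.
exists (z ^+ j)^-1; have := up j; rewrite pj mulr1 => <-.
by rewrite scalerA mulVf ?scale1r // expf_neq0.
Qed.

Definition bicommutant a x := forall b, b * a = a * b -> b * x = x * b.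

(** As [a] commutes with itself, [x] commutes with [a], and [y] commutes with everything that
    does. *)
Lemma bicommutant_comm a x y : bicommutant a x -> bicommutant a y -> x * y = y * x.
Proof. by move=> Dx Dy; apply: Dy; rewrite -Dx. Qed.

Lemma bicommutant_inv a x y :
  x * y = 1 -> y * x = 1 -> bicommutant a x -> bicommutant a y.
Proof.
move=> xy yx Dx b /Dx bx.
by rewrite -[b in LHS]mul1r -yx -!mulrA (mulrA x b) -bx -!mulrA xy mulr1.
Qed.

Lemma bicommutantD a x y : bicommutant a x -> bicommutant a y ->
  bicommutant a (x + y).
Proof. by move=> Dx Dy b ba; rewrite mulrDr mulrDl Dx // Dy. Qed.

Lemma bicommutantM a x y : bicommutant a x -> bicommutant a y ->
  bicommutant a (x * y).
Proof. by move=> Dx Dy b ba; rewrite mulrA Dx // -mulrA Dy // mulrA. Qed.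

Lemma bicommutantZ a x c : bicommutant a x ->
  bicommutant a (c *: x).
Proof. by move=> Dx b ba; rewrite -scalerAr Dx // scalerAl. Qed.

Lemma bicommutant1 a : bicommutant a 1.
Proof. by move=> b _; rewrite mulr1 mul1r. Qed.

Lemma bicommutantX a x n : bicommutant a x -> bicommutant a (x ^+ n).
Proof.
move=> Dx; elim: n => [|n IH]; first exact: bicommutant1.
by rewrite exprS; exact: bicommutantM.
Qed.

Lemma bicommutantB a x y : bicommutant a x -> bicommutant a y ->
  bicommutant a (x - y).
Proof.
by move=> Dx Dy; rewrite -scaleN1r; exact/bicommutantD/bicommutantZ.
Qed.

(** The inverse of [u] is [u ^+ (N - 1) * x']; it is two-sided because the bicommutant is
    commutative. *)
Lemma root_inverse a N u x' : (0 < N)%N -> bicommutant a u -> bicommutant a x' ->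
  u ^+ N * x' = 1 ->
  exists u', [/\ bicommutant a u', u * u' = 1 & u' * u = 1].
Proof.
case: N => // N _ Du Dx' ux'; exists (u ^+ N * x').
have Du' : bicommutant a (u ^+ N * x') by exact/bicommutantM/Dx'/bicommutantX.
by split; rewrite // 1?(bicommutant_comm _ _ _ Du' Du) mulrA -exprS.
Qed.

Lemma exists_root (n : nat) c : (0 < n)%N -> exists w, w ^+ n = c.
Proof. by move=> n0; exists (n.-root c); rewrite rootCK. Qed.

Section PeriodicHom.
Variables (a z : E) (c w : F) (n k : nat) (phi : E -> E).
Hypothesis idemE : forall p : E, p * p = p -> p = 0 \/ p = 1.
Hypotheses (n_gt0 : (0 < n)%N) (k_gt0 : (0 < k)%N).
Hypothesis phiZ : forall c x, phi (c *: x) = c *: phi x.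
Hypothesis phiM : forall x y, phi (x * y) = phi x * phi y.
Hypothesis phiK : forall x, iter n phi x = x.
Hypothesis phia : phi a = w *: a.
Hypothesis w_neq0 : w != 0.

(** Since an iterate of [phi] is the identity, [phi] is onto, and [phi 1] is neutral on its
    image. *)
Lemma periodic_hom1 : phi 1 = 1.
Proof.
have phiS x : exists y, x = phi y.
  by case: n n_gt0 phiK => // m _ h; exists (iter m phi x); rewrite -[LHS]h.
by have [y e] := phiS 1; rewrite -[LHS]mulr1 {2}e -phiM mul1r.
Qed.

Lemma periodic_homX x m : phi (x ^+ m) = phi x ^+ m.
Proof.
by elim: m => [|m IH]; rewrite ?expr0 ?periodic_hom1 // !exprS phiM IH.
Qed.

(** Any [b] commuting with [a] is [phi b'] with [b'] its image under [phi] iterated [n - 1] times.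
    That iterate sends [a] to a nonzero multiple of [a], so [b'] commutes with [a], hence with [x];
    applying [phi] concludes. *)
Lemma periodic_hom_bicommutant x : bicommutant a x -> bicommutant a (phi x).
Proof.
move=> Dx b ba.
have iterM m x1 x2 : iter m phi (x1 * x2) = iter m phi x1 * iter m phi x2.
  by elim: m => //= m ->; rewrite phiM.
have itera m : iter m phi a = w ^+ m *: a.
  by elim: m => [|m /= ->]; rewrite ?scale1r // phiZ phia scalerA exprSr.
have [m nE] : exists m, n = m.+1 by case: (n) n_gt0 => // m _; exists m.
pose b' := iter m phi b.
have bE : b = phi b' by rewrite -[b in LHS]phiK nE.
rewrite bE -!phiM Dx //.
have := congr1 (iter m phi) ba; rewrite !iterM itera -/b' -scalerAl -scalerAr.
by move/(scalerI (expf_neq0 m w_neq0)).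
Qed.

(* a = s z^n for a scalar s, so z is an n-th root of a up to scalars; then
   phi z / z is an n-th root of the scalar w, hence is itself a scalar t, and
   t^n = 1 because phi^n is the identity. *)
Lemma scalar_twist_trivial : (exists b, a * b = 1 /\ b * a = 1) ->
  bicommutant a z -> a ^+ k = c *: z ^+ (n * k) -> w = 1.
Proof.
move=> [b [ab ba]] Dz akE.
have commP x y : x * y = y * x -> GRing.comm x y by [].
have Da : bicommutant a a by [].
have abX m : a ^+ m * b ^+ m = 1.
  by rewrite -exprMn_comm ?ab ?expr1n //; apply: commP; rewrite ab ba.
(* [c *: b ^+ k] inverts [z ^+ (n * k)], so [z] has an inverse [z'] in the bicommutant. *)
have [|||z' [Dz' zz' z'z]] := root_inverse a (n * k) z (c *: b ^+ k) _ Dz.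
- by rewrite muln_gt0 n_gt0.
- exact/bicommutantZ/bicommutantX/(bicommutant_inv _ _ _ ab ba Da).
- by rewrite -scalerAr scalerAl -akE abX.
have a0 : a != 0.
  by apply/eqP => a0; have := oner_neq0 E; rewrite -ab a0 mul0r eqxx.
have zz'X m : z ^+ m * z' ^+ m = 1.
  rewrite -exprMn_comm ?zz' ?expr1n //; apply: commP.
  by rewrite zz' z'z.
have c0 : c != 0.
  apply/eqP => c0; have := oner_neq0 E; rewrite -(abX k) akE c0 scale0r mul0r.
  by rewrite eqxx.
(* [a * z' ^+ n] has [k]-th power the scalar [c]; dividing by a [k]-th root of [c] makes it a root
   of 1. *)
have [c' c'k] := exists_root k c k_gt0.
have c'0 : c' != 0 by apply: contra_neq c0 => c'0; rewrite -c'k c'0 expr0n gtn_eqF.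
have [t0 uE] : exists t, a * z' ^+ n * c'^-1%:A = t%:A.
  apply: (unity_root_scalar k) => //.
  rewrite mulr_algr exprZn exprMn_comm; last first.
    exact/commrX/commP/(bicommutant_comm _ _ _ Da Dz').
  rewrite -exprM akE -scalerAl zz'X scalerA exprVn c'k mulVf ?scale1r //.
pose s := t0 * c'.
have az : a * z' ^+ n = s%:A.
  move: uE; rewrite mulr_algr => /(congr1 ( *:%R c')).
  by rewrite !scalerA mulfV // scale1r mulrC.
have z'zX m : z' ^+ m * z ^+ m = 1.
  by rewrite -exprMn_comm ?z'z ?expr1n //; apply: commP; rewrite zz' z'z.
have aE : a = s *: z ^+ n.
  by rewrite -[LHS]mulr1 -(z'zX n) mulrA az mulr_algl.
have s0 : s != 0 by apply: contra_neq a0 => s0; rewrite aE s0 scale0r.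
have Dphi := periodic_hom_bicommutant _ Dz.
have v_n : (phi z * z') ^+ n = w%:A.
  rewrite exprMn_comm; last exact/commP/(bicommutant_comm _ _ _ Dphi Dz').
  apply: (scalerI s0); rewrite scalerAl -periodic_homX -phiZ -aE phia -scalerAl az.
  by rewrite !scalerA mulrC.
have [w1 w1n] := exists_root n w n_gt0.
have w10 : w1 != 0 by apply: contra_neq w_neq0 => w10; rewrite -w1n w10 expr0n gtn_eqF.
have [t1 vE] : exists t, w1^-1 *: (phi z * z') = t%:A.
  apply: (unity_root_scalar n) => //.
  by rewrite exprZn v_n scalerA exprVn w1n mulVf // scale1r.
pose t := w1 * t1.
have phiz : phi z = t *: z.
  rewrite -[LHS]mulr1 -z'z mulrA -[phi z * z']scale1r -(mulfV w10) -scalerA vE.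
  by rewrite scalerA mulr_algl.
have tn : t ^+ n = 1.
  have itz m : iter m phi z = t ^+ m *: z.
    by elim: m => [|m /= ->]; rewrite ?scale1r // phiZ phiz scalerA exprSr.
  have /(congr1 ( *%R^~ z')) := itz n; rewrite phiK -scalerAl zz' => /esym/eqP.
  rewrite -subr_eq0 -[X in _ - X]scale1r -scalerBl scaler_eq0 oner_eq0 orbF.
  by rewrite subr_eq0 => /eqP.
have : w *: a == 1 *: a.
  by rewrite -phia {1}aE phiZ periodic_homX phiz exprZn tn !scale1r -aE.
by rewrite -subr_eq0 -scalerBl scaler_eq0 (negPf a0) orbF subr_eq0 => /eqP.
Qed.

End PeriodicHom.
End AlgebraLemmas.

(* A copy of A, since a ring structure cannot be joined to a normed module. *)
Definition ring_of {K : numFieldType} (A : banachAlgType K) : Type := A.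

Section RingOf.
Variables (K : numFieldType) (A : banachAlgType K).

HB.instance Definition _ := GRing.Lmodule.copy (ring_of A) A.
HB.instance Definition _ := GRing.Zmodule_isNzRing.Build (ring_of A)
  (@bmulA K A) (@bmul1l K A) (@bmul1r K A) (@bmulDl K A) (@bmulDr K A)
  (@bone_neq0 K A).
HB.instance Definition _ := GRing.Lmodule_isLalgebra.Build K (ring_of A)
  (fun c x y => esym (@bmulZl K A c x y)).
HB.instance Definition _ := GRing.Lalgebra_isAlgebra.Build K (ring_of A)
  (fun c x y => esym (@bmulZr K A c x y)).

Lemma bexpE (x : A) n : bexp x n = (x : ring_of A) ^+ n.
Proof. by elim: n => //= n IH; rewrite exprS -IH. Qed.

End RingOf.

(** * The automorphism that a character induces on a graded algebra *)

Section Grading.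
Variables (R : realType) (A : banachAlgType R[i]) (gT : finGroupType).
Variables (V : gT -> set A) (chi : gT -> R[i]).

(** [phi] multiplies the component of degree [h] by [chi h]. Uniqueness of components makes them
    linear in [x]; multiplicativity of [phi] combines that of [chi] with the inclusion of products
    in the grading. *)
Lemma grading_automorphism : graded_structure V ->
  (forall x y, chi (x * y)%g = chi x * chi y) ->
  (forall x, chi x ^+ #|gT| = 1) ->
  exists phi : A -> A,
    [/\ forall c x, phi (c *: x) = c *: phi x,
        forall x y, phi (x *b y) = phi x *b phi y,
        forall x, iter #|gT| phi x = x
      & forall h v, V h v -> phi v = chi h *: v].
Proof.
move=> [_ Vlin Vdec Vuniq VM] chiM chin.
have [dec decP] := choice Vdec.
have V0 h : V h 0 by have [] := Vlin h.
have VD h x y : V h x -> V h y -> V h (x + y).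
  by move=> Vx Vy; have [_ /(_ 1 x y Vx Vy)] := Vlin h; rewrite scale1r.
have VZ h c x : V h x -> V h (c *: x).
  by move=> Vx; have [_ /(_ c x 0 Vx (V0 h))] := Vlin h; rewrite addr0.
have Vdecx x h : V h (dec x h) by have [] := decP x.
have sdec x : x = \sum_h dec x h by have [] := decP x.
have decD x y h : dec (x + y) h = dec x h + dec y h.
  move: h; apply: Vuniq => // [h|]; first exact: VD.
  by rewrite big_split -!sdec.
have decZ c x h : dec (c *: x) h = c *: dec x h.
  move: h; apply: Vuniq => // [h|]; first exact: VZ.
  by rewrite -scaler_sumr -!sdec.
pose phi x := \sum_h chi h *: dec x h.
have phiD x y : phi (x + y) = phi x + phi y.
  by rewrite /phi -big_split; apply: eq_bigr => h _; rewrite decD scalerDr.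
have phiZ c x : phi (c *: x) = c *: phi x.
  rewrite /phi scaler_sumr; apply: eq_bigr => h _.
  by rewrite decZ !scalerA mulrC.
have phi0 : phi 0 = 0 by have := phiZ 0 0; rewrite !scale0r.
have phiV h v : V h v -> phi v = chi h *: v.
  (* By uniqueness, the components of a homogeneous [v] are [v] in degree [h] and 0 elsewhere. *)
  move=> Vv; have dv := Vuniq (dec v) (fun l => if l == h then v else 0).
  rewrite /phi (eq_bigr (fun l => chi l *: (if l == h then v else 0))).
    rewrite (bigD1 h) //= eqxx big1 ?addr0 // => l /negPf ->.
    by rewrite scaler0.
  move=> l _; congr (_ *: _); apply: dv => // [l'|].
    by case: eqP => [->|].
  by rewrite -sdec -big_mkcond big_pred1_eq.
have phi_sum (I : finType) (f : I -> A) : phi (\sum_i f i) = \sum_i phi (f i).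
  exact: (big_morph phi phiD phi0).
exists phi; split => // [x y|x].
  pose X : ring_of A := x; pose Y : ring_of A := y.
  have xyE : x *b y = \sum_h \sum_l dec x h *b dec y l.
    rewrite {1}(sdec x) {1}(sdec y).
    rewrite -[LHS]/(((\sum_h dec x h : ring_of A) * (\sum_h dec y h))).
    by rewrite mulr_suml; apply: eq_bigr => h _; rewrite mulr_sumr.
  rewrite xyE phi_sum {2 3}/phi.
  rewrite -[RHS]/(((\sum_h (chi h *: dec x h) : ring_of A) *
                   (\sum_h chi h *: dec y h))).
  rewrite mulr_suml; apply: eq_bigr => h _; rewrite phi_sum mulr_sumr.
  apply: eq_bigr => l _; rewrite (phiV (h * l)%g); last exact: VM.
  by rewrite -scalerAl -scalerAr scalerA chiM.
have iterE m : iter m phi x = \sum_h chi h ^+ m *: dec x h.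
  elim: m => [|m /= ->]; first by under eq_bigr do rewrite scale1r.
  rewrite phi_sum; apply: eq_bigr => h _.
  by rewrite phiZ (phiV h) // scalerA exprSr.
by rewrite iterE; under eq_bigr do rewrite chin scale1r.
Qed.

End Grading.

(** * Real-valued norm, completeness and contractions *)

Section RealNorm.
Context {R : realType} {A : completeNormedModType R[i]}.
Implicit Types (x y : A) (e : R).

(* The norm of A takes values in the nonnegative reals of R[i]. *)
Definition rnorm x : R := complex.Re `|x|.

Lemma rnormE x : `|x| = (rnorm x)%:C%C.
Proof. by rewrite RRe_real // ger0_real. Qed.

Lemma rnorm_ge0 x : 0 <= rnorm x.
Proof. by rewrite -ler0c -rnormE normr_ge0. Qed.

Lemma rnorm0 : rnorm 0 = 0.
Proof. by apply: complexI; rewrite -rnormE normr0. Qed.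

Lemma rnorm0_eq0 x : rnorm x = 0 -> x = 0.
Proof. by move=> x0; apply: normr0_eq0; rewrite rnormE x0. Qed.

Lemma rnormN x : rnorm (- x) = rnorm x.
Proof. by apply: complexI; rewrite -!rnormE normrN. Qed.

Lemma rdistC x y : rnorm (x - y) = rnorm (y - x).
Proof. by rewrite -rnormN opprB. Qed.

Lemma ler_rnormD x y : rnorm (x + y) <= rnorm x + rnorm y.
Proof. by rewrite -lecR rmorphD /= -!rnormE ler_normD. Qed.

Lemma ler_rdistD y x z : rnorm (x - z) <= rnorm (x - y) + rnorm (y - z).
Proof. by rewrite (le_trans _ (ler_rnormD _ _)) // addrA subrK. Qed.

Lemma rnormZ (c : R) x : rnorm (c%:C%C *: x) = `|c| * rnorm x.
Proof.
apply: complexI; rewrite rmorphM /= -!rnormE normrZ; congr (_ * _).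
by rewrite normc_def /= expr0n /= addr0 sqrtr_sqr.
Qed.

Lemma rnormMn x n : rnorm (x *+ n) = rnorm x *+ n.
Proof. by apply: complexI; rewrite -!rnormE normrMn rmorphMn /= rnormE. Qed.

Lemma rnorm_complete (u : nat -> A) :
  (forall e, 0 < e -> exists N, forall n, (N <= n)%N -> rnorm (u N - u n) < e) ->
  exists p, forall e, 0 < e ->
    exists N, forall n, (N <= n)%N -> rnorm (p - u n) < e.
Proof.
move=> uC; have : cvg (u @ \oo).
  apply/cauchy_cvgP/cauchy_exP => e e0.
  have eE : (complex.Re e)%:C%C = e by rewrite RRe_real // gtr0_real.
  have [|N Nu] := uC (complex.Re e); first by rewrite -ltcR eE.
  exists (u N), N => // n /Nu Nn; rewrite /= -ball_normE /= rnormE -eE ltcR //.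
move=> /cvg_ex[p /cvgrPdist_lt up]; exists p => e e0.
have [|N _ Nu] := up e%:C%C; first by rewrite ltcR.
by exists N => n /Nu; rewrite rnormE ltcR.
Qed.

Lemma rnorm_nbhs x (P : set A) :
  (exists2 e, 0 < e & forall y, rnorm (y - x) < e -> P y) -> nbhs x P.
Proof.
move=> [e e0 eP]; apply/nbhs_normP; exists e%:C%C; first by rewrite /= ltcR.
by move=> y /=; rewrite distrC rnormE ltcR; exact: eP.
Qed.

(** Banach's fixed point theorem with ratio 1/2; the first hypothesis says that [U] is closed. *)
Lemma half_contraction_fixpoint (U : set A) (f : A -> A) x0 :
  (forall p, (forall e, 0 < e -> exists2 x, U x & rnorm (p - x) < e) -> U p) ->
  U x0 -> (forall x, U x -> U (f x)) ->
  (forall x y, U x -> U y -> rnorm (f x - f y) <= 2^-1 * rnorm (x - y)) ->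
  exists2 p, U p & f p = p.
Proof.
move=> Ucl Ux0 fU fh; pose u n := iter n f x0.
have Uu n : U (u n) by elim: n => //= n; exact: fU.
pose d := rnorm (u 1%N - u 0%N).
have du n : rnorm (u n.+1 - u n) <= 2^-1 ^+ n * d.
  elim: n => [|n IH]; first by rewrite expr0 mul1r.
  rewrite (le_trans (fh _ _ (Uu n.+1) (Uu n))) // exprS -mulrA ler_wpM2l //.
(* The right-hand side is the sum of the bounds [du] for the indices from [n] to [n + m - 1]. *)
have dun n m : rnorm (u n - u (n + m)%N) <= 2 * 2^-1 ^+ n * d - 2 * 2^-1 ^+ (n + m) * d.
  elim: m => [|m IH]; first by rewrite addn0 !subrr rnorm0.
  rewrite (le_trans (ler_rdistD (u (n + m)%N) _ _)) //.
  rewrite addnS [X in _ + X]rdistC (le_trans (lerD IH (du _))) // exprS.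
  lra.
have hn n : 0 <= 2^-1 ^+ n :> R by rewrite exprn_ge0.
have d0 : 0 <= d := rnorm_ge0 _.
have [|p pu] := rnorm_complete u.
  move=> e e0.
  have [N Ne] : exists N, 2 * 2^-1 ^+ N * d < e.
    have /cvgrPdist_lt/(_ e e0)[N _ Ne] : geometric (2 * d) 2^-1 @ \oo --> (0 : R).
      by apply: cvg_geometric; rewrite ger0_norm; lra.
    exists N; have := Ne N (leqnn N) => /=.
    rewrite sub0r normrN ger0_norm ?mulr_ge0 //.
    by rewrite mulrAC.
  exists N => n Nn; rewrite -(subnKC Nn) (le_lt_trans (dun _ _)) //.
  by rewrite (le_lt_trans _ Ne) // gerBl !mulr_ge0.
have Up : U p.
  apply: Ucl => e e0; have [N Np] := pu e e0.
  by exists (u N) => //; exact: Np.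
exists p => //; apply/subr0_eq/rnorm0_eq0/eqP; rewrite eq_le rnorm_ge0 andbT.
apply/ler_addgt0Pl => e e0; rewrite addr0.
have [|N Np] := pu (e / 2); first lra.
rewrite (le_trans (ler_rdistD (u N.+1) _ _)) // [X in _ + X]rdistC.
have := Np _ (leqnSn N); have := Np _ (leqnn N).
have := fh _ _ Up (Uu N); rewrite -[f (u N)]/(u N.+1); lra.
Qed.

End RealNorm.

(** * Roots near 1 and powers in connected sets of invertible elements *)

Section LocalRoots.
Context {R : realType} {A : banachAlgType R[i]}.
Local Notation E := (ring_of A).
Implicit Types (a b u v w x y z p : E).

Definition nrm (x : E) : R := rnorm (x : A).

Lemma nrm_ge0 x : 0 <= nrm x. Proof. exact: rnorm_ge0. Qed.

Lemma nrm0 : nrm 0 = 0. Proof. exact: rnorm0. Qed.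

Lemma nrm_distC x y : nrm (x - y) = nrm (y - x). Proof. exact: rdistC. Qed.

Lemma ler_nrmD x y : nrm (x + y) <= nrm x + nrm y.
Proof. exact: ler_rnormD. Qed.

Lemma ler_nrmB x y : nrm (x - y) <= nrm x + nrm y.
Proof. by rewrite -[nrm y]rnormN; exact: ler_nrmD. Qed.

Lemma nrmZ (c : R) x : nrm (c%:C%C *: x) = `|c| * nrm x.
Proof. exact: rnormZ. Qed.

Lemma nrmMn x n : nrm (x *+ n) = nrm x *+ n.
Proof. exact: rnormMn. Qed.

Lemma ler_nrmM x y : nrm (x * y) <= nrm x * nrm y.
Proof.
rewrite -lecR rmorphM /= -!rnormE; exact: (@bnormM R[i] A x y).
Qed.

Lemma ler_nrmM_bound x y (c d : R) : nrm x <= c -> nrm y <= d -> nrm (x * y) <= c * d.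
Proof.
move=> xc yd; rewrite (le_trans (ler_nrmM _ _)) // ler_pM ?nrm_ge0 //.
Qed.

(** The commutator of [b] with [p] equals that with [p - x], of norm at most twice
    [nrm b * nrm (p - x)]. The [+ 1] in the tolerance keeps the denominator positive when [b] is
    0. *)
Lemma bicommutant_closed a p :
  (forall e : R, 0 < e -> exists2 x, bicommutant a x & nrm (p - x) < e) ->
  bicommutant a p.
Proof.
move=> ap b ba; apply/subr0_eq/(@rnorm0_eq0 R A)/eqP; rewrite eq_le rnorm_ge0 andbT.
apply/ler_addgt0Pl => e e0; rewrite addr0.
have b0 := nrm_ge0 b.
have [|x Dx px] := ap (e / (2 * (nrm b + 1))); first by rewrite divr_gt0 //; lra.
have -> : b * p - p * b = b * (p - x) - (p - x) * b.
  by rewrite mulrBr mulrBl (Dx _ ba) opprB addrA subrK.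
rewrite (le_trans (ler_nrmB _ _)) //.
have := ler_nrmM b (p - x); have := ler_nrmM (p - x) b.
have : nrm b * nrm (p - x) <= e / 2.
  rewrite (@le_trans _ _ ((nrm b + 1) * (e / (2 * (nrm b + 1))))) //.
    by rewrite ler_pM ?nrm_ge0 ?(ltW px) //; lra.
  by rewrite le_eqVlt; apply/orP; left; apply/eqP; field; rewrite gt_eqF //; lra.
rewrite -/(nrm _) [nrm (p - x) * _]mulrC; lra.
Qed.

(** The terms of degree at least 2 in the binomial expansion, hence a map with small Lipschitz
    constant near 0. *)
Definition pow_remainder n w : E := (1 + w) ^+ n - 1 - w *+ n.

Lemma pow_remainderS n w :
  pow_remainder n.+1 w = pow_remainder n w + w * (pow_remainder n w + w *+ n).
Proof.
rewrite /pow_remainder subrK exprS mulrS mulrDl mul1r mulrBr mulr1.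
by rewrite opprD !addrA [LHS](ACl (1*3*5*2*4)%AC).
Qed.

Lemma pow_remainder0 n : pow_remainder n 0 = 0.
Proof. by rewrite /pow_remainder addr0 expr1n subrr mul0rn subrr. Qed.

(** Induction on [n] through [pow_remainderS]. The factor [r] in the bound is what yields a
    contraction on small balls. *)
Lemma pow_remainder_lipschitz n : exists2 K : R, 0 <= K &
  forall r w w', 0 <= r -> r <= 1 -> nrm w <= r -> nrm w' <= r ->
  nrm (pow_remainder n w - pow_remainder n w') <= K * r * nrm (w - w').
Proof.
elim: n => [|n [K K0 IH]].
  exists 0 => // r w w' *; rewrite /pow_remainder !expr0 !mulr0n !subrr nrm0.
  by rewrite !mul0r.
(* The three terms of [splitE] contribute [K], [K + n] and [K + n], each times
   [r * nrm (w - w')]. *)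
exists (3 * K + 2 * n%:R) => [|r w w' r0 r1 wr w'r].
  by rewrite addr_ge0 // mulr_ge0.
have splitE q q' : (q + w * (q + w *+ n)) - (q' + w' * (q' + w' *+ n)) =
   (q - q') + (w * ((q - q') + (w - w') *+ n) + (w - w') * (q' + w' *+ n)).
  rewrite opprD addrACA; congr (_ + _).
  have -> : q - q' + (w - w') *+ n = (q + w *+ n) - (q' + w' *+ n).
    by rewrite mulrnBl opprD addrACA.
  by rewrite mulrBr mulrBl addrA subrK.
rewrite !pow_remainderS splitE {splitE}.
set q := pow_remainder n w; set q' := pow_remainder n w'.
set d := nrm (w - w'); have d0 : 0 <= d := nrm_ge0 _.
have qq : nrm (q - q') <= K * r * d by exact: IH.
have q'r : nrm q' <= K * r.
  have := IH r w' 0 r0 r1 w'r; rewrite nrm0 => /(_ r0).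
  rewrite pow_remainder0 !subr0 => /le_trans -> //.
  by rewrite ler_piMr ?mulr_ge0 // (le_trans w'r).
have h1 : nrm (q - q' + (w - w') *+ n) <= K * d + n%:R * d.
  apply: (le_trans (ler_nrmD _ _)); apply: lerD.
    by apply: (le_trans qq); apply: ler_wpM2r => //; exact: ler_piMr.
  by rewrite nrmMn -[nrm _ *+ n]mulr_natl.
have h2 : nrm (q' + w' *+ n) <= K * r + n%:R * r.
  apply: (le_trans (ler_nrmD _ _)); apply: lerD => //.
  by rewrite nrmMn -[nrm _ *+ n]mulr_natl ler_wpM2l.
have h3 := ler_nrmM_bound _ _ _ _ wr h1.
have h4 := ler_nrmM_bound _ _ _ _ (lexx d) h2.
apply: (le_trans (ler_nrmD _ _)).
apply: (le_trans (lerD qq (ler_nrmD _ _))).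
apply: (le_trans (lerD (lexx _) (lerD h3 h4))).
by rewrite le_eqVlt; apply/orP; left; apply/eqP; ring.
Qed.

(* The equation (1 + w)^N = 1 + v is the fixed point equation
   w = (v - pow_remainder N w) / N. *)
Lemma root_near1 a N : (0 < N)%N -> exists2 e : R, 0 < e &
  forall v, bicommutant a v -> nrm v < e ->
  exists2 w, bicommutant a w & w ^+ N = 1 + v.
Proof.
move=> N0; have [K K0 KP] := pow_remainder_lipschitz N.
(* With [K * r] at most 1/2, the map [f] below halves distances on the ball of radius [r]; as
   [nrm (f 0)] is at most [r / 2], it preserves this ball. *)
pose r : R := (2 * (K + 1))^-1.
have r0 : 0 < r by rewrite invr_gt0; lra.
have rE : r * (K + 1) = 2^-1 by rewrite /r; field; rewrite gt_eqF //; lra.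
have r1 : r <= 1 by nra.
have Kr : K * r <= 2^-1 by nra.
exists (r / 2) => [|v Dv vr]; first lra.
pose c : R := N%:R^-1.
have c0 : 0 <= c by rewrite invr_ge0.
have c1 : c <= 1 by rewrite invf_le1 ?ler1n // ltr0n.
pose f w : E := c%:C%C *: (v - pow_remainder N w).
have Dr w : bicommutant a w -> bicommutant a (pow_remainder N w).
  move=> Dw; have D1 := bicommutant1 a; rewrite /pow_remainder.
  apply: bicommutantB; last by rewrite -scaler_nat; exact: bicommutantZ.
  by apply: bicommutantB => //; exact/bicommutantX/bicommutantD.
have subBB (q q' : E) : (v - q) - (v - q') = q' - q.
  by rewrite opprB addrC addrA subrK.
have fL w w' : nrm w <= r -> nrm w' <= r -> nrm (f w - f w') <= 2^-1 * nrm (w - w').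
  move=> wr w'r; rewrite /f -scalerBr subBB nrmZ ger0_norm //.
  have := KP r _ _ (ltW r0) r1 w'r wr; rewrite [nrm (w' - w)]nrm_distC.
  have := nrm_ge0 (w - w'); have := nrm_ge0 (pow_remainder N w' - pow_remainder N w).
  nra.
have f0 : nrm (f 0) <= r / 2.
  rewrite /f pow_remainder0 subr0 nrmZ ger0_norm //; have := nrm_ge0 v; nra.
have [w Dw fw] : exists2 w : E, bicommutant a w & f w = w.
  have [] := @half_contraction_fixpoint R A
    [set w : A | bicommutant (a : E) w /\ rnorm w <= r] f 0; last first.
  - by move=> w [Dw _] fw; exists w.
  - by move=> x y [_ xr] [_ yr]; exact: fL.
  - move=> w [Dw wr]; split; first exact/bicommutantZ/bicommutantB/Dr.
    have := fL w 0 wr; rewrite nrm0 subr0 => /(_ (ltW r0)).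
    have := ler_nrmD (f w - f 0) (f 0); rewrite subrK /nrm.
    by move: f0; rewrite /nrm; lra.
  - by split; [move=> b _; rewrite mulr0 mul0r | rewrite rnorm0 ltW].
  - move=> p pU; split.
      apply: bicommutant_closed => e e0; have [x [Dx _] xp] := pU e e0.
      by exists x.
    apply/ler_addgt0Pl => e e0; have [x [_ xr] xp] := pU e e0.
    have := ler_rnormD (p - x) x; rewrite subrK; lra.
exists (1 + w); first exact/bicommutantD/Dw/bicommutant1.
have vw : v - pow_remainder N w = w *+ N.
  rewrite -[in RHS]fw /f -[RHS]scaler_nat scalerA.
  have -> : N%:R * c%:C%C = 1 :> R[i].
    rewrite -(rmorph_nat (real_complex R)) -rmorphM /= mulfV ?rmorph1 //.
    by rewrite pnatr_eq0 -lt0n.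
  by rewrite scale1r.
have : pow_remainder N w = v - w *+ N by rewrite -vw subKr.
by rewrite /pow_remainder => /addIr <-; rewrite [RHS]addrC subrK.
Qed.

(** If [x] is close to [y] in [S], then [x] is [y] times an element near 1, which is the [N]-th
    power of some invertible [u] in the bicommutant. Multiplying by [u] or its inverse carries roots
    of [y] to roots of [x] and back, so the powers are relatively clopen in [S]. *)
Lemma connected_powers a N (S : set A) : (0 < N)%N ->
  connected S -> S bone -> (forall x, S x -> bicommutant a x /\ invertible x) ->
  forall x, S x -> exists2 z, bicommutant a z & z ^+ N = x.
Proof.
move=> N0 cS S1 SP.
pose Q (x : A) := exists2 z : E, bicommutant a z & z ^+ N = x.
have [e e0 rt] := root_near1 a N N0.
have {}SP (x : E) : S x ->
    exists x', [/\ bicommutant a x, bicommutant a x', x * x' = 1 & x' * x = 1].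
  move=> /SP[Dx [x' [xx' x'x]]]; exists x'; split => //.
  exact: (bicommutant_inv _ x x' xx' x'x Dx).
have commX x y : bicommutant a x -> bicommutant a y ->
    (x * y) ^+ N = x ^+ N * y ^+ N.
  by move=> Dx Dy; apply/exprMn_comm/(bicommutant_comm _ _ _ Dx Dy).
have local (y : E) : S y -> exists2 d : R, 0 < d &
    forall x : E, nrm (x - y) < d -> S x -> (Q x <-> Q y).
  move=> /SP[y' [Dy Dy' yy' y'y]]; have y'0 := nrm_ge0 y'.
  (* This radius gives [nrm (y' * (x - y)) < e], so that [root_near1] applies to
     [y' * x = 1 + y' * (x - y)]. *)
  exists (e / (nrm y' + 1)); first by rewrite divr_gt0 //; lra.
  move=> x xy /SP[x' [Dx Dx' xx' x'x]].
  have [u Du uN] : exists2 u : E, bicommutant a u & u ^+ N = y' * x.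
    have [||u Du uE] := rt (y' * (x - y)).
    - exact/bicommutantM/bicommutantB.
    - apply: (le_lt_trans (ler_nrmM _ _)).
      move: xy; rewrite ltr_pdivlMr; last lra.
      have := nrm_ge0 (x - y); nra.
    - by exists u => //; rewrite uE mulrBr y'y addrC subrK.
  have [] := root_inverse a N u (x' * y) N0 Du (bicommutantM _ _ _ Dx' Dy).
    by rewrite uN -mulrA (mulrA x) xx' mul1r y'y.
  move=> u' [Du' uu' u'u].
  split=> [[z Dz zE]|[z Dz zE]].
  - exists (z * u'); first exact: bicommutantM.
    rewrite commX // zE -[x in LHS]mul1r -yy' -[y * y' * x]mulrA -uN -mulrA.
    by rewrite -commX // uu' expr1n mulr1.
  - exists (z * u); first exact: bicommutantM.
    by rewrite commX // zE uN mulrA yy' mul1r.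
suff SQ : S `&` Q = S by move=> x; rewrite -{1}SQ => -[].
apply: cS.
- by exists bone; split => //; exists (1 : E); [exact: bicommutant1|rewrite expr1n].
(* The implication imposes nothing outside [S], so a condition local to [S] becomes an open set of
   the whole algebra. *)
- exists (interior [set x | S x -> Q x]); first exact: open_interior.
  apply/seteqP; split => [y [Sy Qy]|y [Sy /interior_subset]]; last by split; auto.
  split => //; apply: rnorm_nbhs; have [d d0 dP] := local y Sy.
  by exists d => // x xy Sx; apply/(dP x xy Sx).
- exists (~` interior [set x | S x -> ~ Q x]).
    by rewrite closedC; exact: open_interior.
  apply/seteqP; split => [y [Sy Qy]|y [Sy yN]].
    by split => // /interior_subset /(_ Sy).
  split => //; apply: contrapT => Qy; apply: yN; apply: rnorm_nbhs.
  have [d d0 dP] := local y Sy.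
  by exists d => // x xy Sx; apply: contra_not Qy => /(dP x xy Sx).
Qed.

End LocalRoots.

(** * Segments of invertible elements and convex hulls *)

Lemma connected_segment (R : realType) (A : banachAlgType R[i]) (x y : A) :
  connected [set (1 - t)%:C%C *: x + t%:C%C *: y | t in `[0 : R, 1]].
Proof.
apply: connected_continuous_connected; first exact: segment_connected.
apply: continuous_subspaceT => t; apply/cvgrPdist_lt => e e0.
have eE : (complex.Re e)%:C%C = e by rewrite RRe_real // gtr0_real.
have re0 : 0 < complex.Re e by rewrite -ltcR eE.
have d0 := rnorm_ge0 (y - x).
apply/nbhs_normP; exists (complex.Re e / (rnorm (y - x) + 1)).
  by rewrite /= divr_gt0 //; lra.
move=> s /=; rewrite ltr_pdivlMr => [ts|]; last lra.
have -> : (1 - t)%:C%C *: x + t%:C%C *: y - ((1 - s)%:C%C *: x + s%:C%C *: y) =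
    (t - s)%:C%C *: (y - x).
  rewrite opprD addrACA -!scalerBl -!rmorphB /= scalerBr [RHS]addrC -scaleNr.
  by rewrite -rmorphN /=; congr (_%:C%C *: _ + _); lra.
rewrite rnormE -eE ltcR rnormZ; have := normr_ge0 (t - s); nra.
Qed.

Section Ray.
Variables (R : realType) (A : banachAlgType R[i]).
Local Notation E := (ring_of A).
Implicit Types (a x : E).

Lemma invertibleZ (c : R[i]) (x : A) : c != 0 -> invertible x -> invertible (c *: x).
Proof.
move=> c0 [y [xy yx]]; exists (c^-1 *: y).
rewrite !bmulZl !bmulZr !scalerA mulfV // mulVf // !scale1r; split => //.
Qed.

(** For [t] in ]0, 1], [(1 - t) + t x] is [t] times [x - l] with [l = - (1 - t) / t] nonpositive. So
    the segment from 1 to [x] consists of invertible elements. *)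
Lemma missed_ray_power a N x : (0 < N)%N -> bicommutant a x ->
  (forall l : R, l <= 0 -> invertible ((x : A) - l%:C%C *: bone)) ->
  exists2 z, bicommutant a z & z ^+ N = x.
Proof.
move=> N0 Dx xl.
apply: (connected_powers a N _ N0 (connected_segment R A bone x)).
- by exists 0; rewrite /= ?in_itv /= ?lexx ?ler01 // subr0 scale1r scale0r addr0.
- move=> _ /= [t + <-]; rewrite in_itv /= => /andP[t0 t1]; split.
    exact/(@bicommutantD _ (ring_of A))/bicommutantZ/Dx/bicommutantZ/bicommutant1.
  have [->|tn0] := eqVneq t 0.
    rewrite subr0 scale1r scale0r addr0; exists bone.
    by rewrite !bmul1l.
  have -> : (1 - t)%:C%C *: bone + t%:C%C *: (x : A) =
      t%:C%C *: ((x : A) - (- (1 - t) / t)%:C%C *: bone).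
    rewrite scalerBr scalerA -rmorphM /= addrC -scaleNr -rmorphN /=.
    by congr (_ + _%:C%C *: _); field.
  apply: invertibleZ; first by rewrite -[0](rmorph0 (real_complex R)) (inj_eq (@complexI R)).
  apply: xl; rewrite mulNr oppr_le0 divr_ge0 //; lra.
- by exists 1; rewrite /= ?in_itv /= ?lexx ?ler01 // subrr scale1r scale0r add0r.
Qed.

End Ray.

Lemma convex_hull_C_mem (R : realType) (S : set R[i]) z : S z -> convex_hull_C S z.
Proof.
move=> Sz; exists 1%N, (fun=> 1), (fun=> z).
by split => // [|]; rewrite big_ord1 ?mul1r.
Qed.

Lemma convex_hull_C_opposite_reals (R : realType) (S : set R[i]) (l m : R) :
  l < 0 -> 0 < m -> S l%:C%C -> S m%:C%C -> convex_hull_C S 0.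
Proof.
move=> l0 m0 Sl Sm.
exists 2%N, (fun i : 'I_2 => if i == 0 then m / (m - l) else - l / (m - l)),
  (fun i : 'I_2 => if i == 0 then l%:C%C else m%:C%C).
have ml : m - l != 0 by rewrite gt_eqF //; lra.
split => [i||i|]; rewrite ?big_ord_recl ?big_ord0 /=.
- by case: ifP => _; rewrite divr_ge0 //; lra.
- by rewrite addr0 -mulrDl mulfV.
- by case: ifP.
- rewrite addr0 -!rmorphM -rmorphD /=.
  by rewrite -[LHS](rmorph0 (real_complex R)); congr (_%:C%C); field.
Qed.

(** * The two conclusions, through the spectrum and through the identity component *)

Theorem mainTheorem1 (gT : finGroupType) (k : nat) (R : realType)
  (A : banachAlgType R[i]) (V : gT -> set A) :
  abelian (finset.setT : {set gT}) ->
  (0 < k)%N ->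
  graded_structure V ->
  (forall p : A, ~ nontrivial_idempotent p) ->
  forall (g : gT) (a : A), g != 1%g -> V g a ->
    convex_hull_C (spectrum (bexp a k)) 0 /\
    ((forall x y : A, x *b y = y *b x) -> invertible a ->
       ~ connected_component (@invertibles _ A) bone (bexp a k)).
Proof.
move=> abG k0 gradV noidem g a g1 Va.
have [chi [chiM chin chig]] := abelian_separating_char R[i] gT g abG g1.
have [phi [phiZ phiM phiK phiV]] := grading_automorphism _ _ _ _ _ gradV chiM chin.
have n0 : (0 < #|gT|)%N by apply/card_gt0P; exists g.
have idemE (p : ring_of A) : p * p = p -> p = 0 \/ p = 1.
  move=> pp; apply: contrapT => /not_orP[p0 p1].
  by apply: (noidem p); split.
have chig0 : chi g != 0.
  apply: contra_eq_neq (chin g) => ->.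
  by rewrite expr0n gtn_eqF // eq_sym oner_neq0.
have Da : bicommutant (a : ring_of A) a by [].
(* The contradiction shared by both conclusions; the scalar [c] allows for the sign when [-a^k] is
   the power found. *)
have key (c : R[i]) (z : ring_of A) : invertible a ->
    bicommutant (a : ring_of A) z ->
    (a : ring_of A) ^+ k <> c *: z ^+ (#|gT| * k).
  move=> inva Dz akE; move: chig => /eqP; apply.
  apply: (@scalar_twist_trivial _ (ring_of A) a z c (chi g) #|gT| k phi) => //.
  exact: phiV.
have N0 : (0 < #|gT| * k)%N by rewrite muln_gt0 n0.
split.
  rewrite bexpE; set x := (a : ring_of A) ^+ k.
  have Dx : bicommutant (a : ring_of A) x by exact: bicommutantX.
  have [[x' [xx' x'x]]|ninvx] := pselect (invertible (x : A)); last first.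
    by apply: convex_hull_C_mem; rewrite /spectrum /= scale0r subr0.
  have inva : invertible a.
    have [|u [_ au ua]] := root_inverse (a : ring_of A) k a x' k0 Da _ xx'.
      exact: (bicommutant_inv _ x x' xx' x'x Dx).
    by exists u.
  have spec0 (l : R) : spectrum (x : A) l%:C%C -> l != 0.
    apply: contraPneq => ->; rewrite /spectrum /= => ninv; apply: ninv.
    by rewrite (rmorph0 (real_complex R)) scale0r subr0; exists x'.
  have [[l l0 lx]|nol] := pselect (exists2 l : R, l <= 0 & spectrum (x : A) l%:C%C);
    last first.
    have [|z Dz zE] := missed_ray_power _ _ (a : ring_of A) _ x N0 Dx.
      by move=> l l0; apply: contrapT => lx; apply: nol; exists l.
    by case: (key 1 z inva Dz); rewrite zE scale1r.
  (* If the spectrum of [x] misses the nonnegative reals, that of [-x] misses the nonpositive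
     ones. *)
  have [[m m0 mx]|nom] := pselect (exists2 m : R, 0 <= m & spectrum (x : A) m%:C%C);
    last first.
    have [||z Dz zE] := missed_ray_power _ _ (a : ring_of A) _ (-1 *: x) N0.
    - exact: bicommutantZ.
    - move=> m m0; have negE (X : A) : -1 *: X - m%:C%C *: bone =
          -1 *: (X - (- m)%:C%C *: bone).
        by rewrite rmorphN /= [X in _ *: (_ - X)]scaleNr opprK scalerDr !scaleN1r.
      suff : invertible (-1 *: ((x : A) - (- m)%:C%C *: bone)) by rewrite -negE.
      apply: invertibleZ; first by rewrite oppr_eq0 oner_neq0.
      by apply: contrapT => mx; apply: nom; exists (- m); rewrite ?oppr_ge0.
    by case: (key (-1) z inva Dz); rewrite zE scalerA mulrNN mulr1 scale1r.
  apply: (convex_hull_C_opposite_reals _ _ l m _ _ lx mx).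
    by rewrite lt_neqAle spec0.
  by rewrite lt_neqAle eq_sym spec0.
(* [S] is a connected set of invertible elements containing 1 and [a^k]; by commutativity the
   bicommutant of [a] is all of [A]. *)
move=> commA inva [S [S1 Sinv cS] Sx].
have [|z Dz zE] := connected_powers (a : ring_of A) _ S N0 cS S1 _ _ Sx.
  by move=> x Sx'; split; [move=> b _; exact: commA | exact: Sinv].
by apply: (key 1 z inva Dz); rewrite zE scale1r bexpE.
Qed.
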